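(* Let $\beta>1$ be a Parry number whose Parry polynomial $n_{\beta}^{*}(X)$ has degree $d_P\geq 1$, and let $0<\epsilon<1$. Let $\mu_{\epsilon}$ denote $1/d_P$ times the number of roots of $n_{\beta}^{*}(X)$ (counted with multiplicity) which lie in $\Omega$ but outside the closed annulus $\{z\in\mathbb{C} : 1-\epsilon\leq |z|\leq (1-\epsilon)^{-1}\}$. Then (i) $\displaystyle \mu_{\epsilon}\leq \frac{2}{\epsilon\, d_P}\left({\rm Log}\|n_{\beta}^{*}\|_2-\frac{1}{2}{\rm Log}\,\beta\right)$, and (ii) $\displaystyle \mu_{\epsilon}\leq \frac{2}{\epsilon\, d_P}\left({\rm Log}\|n_{\beta}^{*}\|_1-\frac{1}{2}{\rm Log}\,|n_{\beta}^{*}(0)|\right)$.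
   Context: Let $\beta>1$ be a non-integer real number. Its R\'enyi $\beta$-expansion of unity is $d_\beta(1)=0.t_1t_2t_3\ldots$ where $t_1=\lfloor\beta\rfloor$ and $t_{j+1}=\lfloor \beta T_\beta^{j}(1)\rfloor$, with $T_\beta(x)=\beta x-\lfloor \beta x\rfloor$ and $T_\beta^j$ its $j$-th iterate; then $1=\sum_{i\ge1}t_i\beta^{-i}$. $\beta$ is a Parry number if $(t_i)$ is eventually periodic, and simple if $t_i=0$ for all large $i$. Parry polynomial: if $\beta$ is simple with last nonzero digit $t_m$, $n_\beta^*(X)=X^m-\sum_{i=1}^m t_iX^{m-i}$. If $\beta$ is non-simple with preperiod length $m\ge0$ and period length $p+1\ge1$ (minimal, $t_{i+p+1}=t_i$ for $i>m$): if $m\ge1$, $n_\beta^*(X)=X^{m+p+1}-\sum_{i=1}^{m+p+1}t_iX^{m+p+1-i}-X^m+\sum_{i=1}^{m}t_iX^{m-i}$; if $m=0$, $n_\beta^*(X)=X^{p+1}-\sum_{i=1}^{p}t_iX^{p+1-i}-(1+t_{p+1})$. It is monic in $\mathbb{Z}[X]$, vanishes at $\beta$; $d_P$ is its degree. Solomyak's set: let $\mathcal{G}$ be the set of $\xi$ in the open unit disk such that $f(\xi)=0$ for some $f(z)=1+\sum_{j\ge1}a_jz^j$ with all $0\le a_j\le1$; $\Omega:=\{\xi^{-1}:\xi\in\mathcal{G}\}\cup\{|z|\le1\}$. For $Q(X)=\sum_j\alpha_jX^j$, $\|Q\|_2=(\sum_j|\alpha_j|^2)^{1/2}$ and $\|Q\|_1=\sum_j|\alpha_j|$.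 ${\rm Log}$ is the natural logarithm. *)

(* Defs.v *)
From HB Require Import structures.
From mathcomp Require Import all_boot all_order all_algebra.
From mathcomp Require Import boolp classical_sets reals topology normedtype.
From mathcomp Require Import sequences exp.
From mathcomp Require Export complex.
Set Implicit Arguments.
Unset Strict Implicit.
Unset Printing Implicit Defensive.
Import Order.TTheory GRing.Theory Num.Theory.
Import numFieldNormedType.Exports.
Local Open Scope classical_set_scope.
Local Open Scope ring_scope.
Local Open Scope complex_scope.

Section RenyiExpansion.
Variables (R : realType) (beta : R).

Definition beta_transformation (x : R) : R :=
  beta * x - (Num.floor (beta * x))%:~R.

(* Digits are numbered from 1; the value at 0 is meaningless, and every
   statement below only looks at positive indices. *)
Definition renyi_digit (i : nat) : int :=
  Num.floor (beta * iter i.-1 beta_transformation 1).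

Local Notation t := renyi_digit.

(* The period length is p.+1. *)
Definition periodic_after (m p : nat) : Prop :=
  forall i, (m < i)%N -> t (i + p.+1) = t i.

Definition parry_number : Prop := exists m p, periodic_after m p.

Definition simple_parry_number : Prop :=
  exists m, forall i, (m < i)%N -> t i = 0.

Definition is_last_nonzero_digit (m : nat) : Prop :=
  [/\ (0 < m)%N, t m != 0 & forall i, (m < i)%N -> t i = 0].

Definition is_minimal_period (m p : nat) : Prop :=
  periodic_after m p /\
  forall m' p', periodic_after m' p' -> (m <= m')%N /\ (p <= p')%N.

Variant is_parry_poly : {poly int} -> Prop :=
| ParrySimple m of is_last_nonzero_digit m :
    is_parry_poly ('X^m - \sum_(1 <= i < m.+1) t i *: 'X^(m - i))
| ParryNonSimple m p of ~ simple_parry_number & is_minimal_period m p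
    & (0 < m)%N :
    is_parry_poly
      ('X^(m + p.+1)
       - \sum_(1 <= i < (m + p.+1).+1) t i *: 'X^(m + p.+1 - i)
       - 'X^m + \sum_(1 <= i < m.+1) t i *: 'X^(m - i))
| ParryPurelyPeriodic p of ~ simple_parry_number & is_minimal_period 0 p :
    is_parry_poly
      ('X^(p.+1) - \sum_(1 <= i < p.+1) t i *: 'X^(p.+1 - i)
       - (1 + t p.+1)%:P).

End RenyiExpansion.

Section ParryPolyWellDefined.
Variables (R : realType) (beta : R).
Local Notation t := (renyi_digit beta).

Lemma periodic_afterMn m p k i :
  periodic_after beta m p -> (m < i)%N -> t (i + k * p.+1) = t i.
Proof.
move=> h mi; elim: k => [|k IH]; first by rewrite mul0n addn0.
by rewrite mulSn addnCA addnC h ?IH // ltn_addr.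
Qed.

Lemma minimal_period_exists :
  parry_number beta -> exists m p, is_minimal_period beta m p.
Proof.
move=> [m0 [p0 h0]].
have exm : exists m, `[< exists p, periodic_after beta m p >].
  by exists m0; apply/asboolP; exists p0.
case: (ex_minnP exm) => m /asboolP[p1 h1] mmin.
have exp' : exists p, `[< periodic_after beta m p >].
  by exists p1; apply/asboolP.
case: (ex_minnP exp') => p /asboolP hp pmin.
exists m, p; split=> // m' q hq; split.
  by apply: mmin; apply/asboolP; exists q.
apply: pmin; apply/asboolP => i mi.
rewrite -(periodic_afterMn m'.+1 hp mi).
rewrite -(periodic_afterMn m'.+1 hp (ltn_addr q.+1 mi)) addnAC hq //.
rewrite (leq_trans _ (leq_addl _ _)) //.
by rewrite leq_pmulr.
Qed.

Lemma simple_parry_last_digit : 1 < beta ->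
  simple_parry_number beta -> exists m, is_last_nonzero_digit beta m.
Proof.
move=> b1 [m0 h0].
have exm : exists m, `[< forall i, (m < i)%N -> t i = 0 >].
  by exists m0; apply/asboolP.
case: (ex_minnP exm) => m /asboolP hm mmin; exists m.
have t1 : t 1 != 0.
  rewrite /renyi_digit /= mulr1 gt_eqF //.
  by rewrite -[ltLHS]add0r -lezD1 add0r floor_ge_int // ltW.
have m0' : (0 < m)%N by case: (m) hm => // /(_ 1%N isT) /eqP; rewrite (negPf t1).
split=> //; apply/eqP => tm0.
have : (m <= m.-1)%N.
  apply: mmin; apply/asboolP => i; rewrite prednK // leq_eqVlt.
  by case/predU1P => [<-|/hm].
by rewrite -ltnS prednK // ltnn.
Qed.

Lemma parry_poly_exists : 1 < beta ->
  parry_number beta -> exists n, is_parry_poly beta n.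
Proof.
move=> b1 hb; have [hs|hs] := pselect (simple_parry_number beta).
  by have [m hm] := simple_parry_last_digit b1 hs; eexists; apply: ParrySimple hm.
have [[|m] [p hmp]] := minimal_period_exists hb.
  by eexists; apply: ParryPurelyPeriodic hs hmp.
by eexists; apply: ParryNonSimple hs hmp isT.
Qed.

Lemma parry_poly_unique n n' :
  is_parry_poly beta n -> is_parry_poly beta n' -> n = n'.
Proof.
have simpleP m : is_last_nonzero_digit beta m -> simple_parry_number beta.
  by case=> _ _ hm; exists m.
have lastP m m' : is_last_nonzero_digit beta m ->
    is_last_nonzero_digit beta m' -> m = m'.
  move=> [_ tm hm] [_ tm' hm']; case: (ltngtP m m') => // /[dup].
    by move=> /hm /eqP; rewrite (negPf tm').
  by move=> /hm' /eqP; rewrite (negPf tm).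
have perP m p m' p' : is_minimal_period beta m p ->
    is_minimal_period beta m' p' -> m = m' /\ p = p'.
  move=> [h hmin] [h' hmin'].
  have [a b] := hmin _ _ h'; have [a' b'] := hmin' _ _ h.
  by split; apply/eqP; rewrite eqn_leq ?a ?a' ?b ?b'.
case=> [m hm|m p hs hmp m0|p hs hp] [m' hm'|m' p' hs' hmp' m0'|p' hs' hp'].
- by rewrite (lastP _ _ hm hm').
- by case: hs'; apply: simpleP hm.
- by case: hs'; apply: simpleP hm.
- by case: hs; apply: simpleP hm'.
- by have [-> ->] := perP _ _ _ _ hmp hmp'.
- by have [e _] := perP _ _ _ _ hmp hp'; rewrite e in m0.
- by case: hs; apply: simpleP hm'.
- by have [e _] := perP _ _ _ _ hp hmp'; rewrite -e in m0'.
- by have [_ ->] := perP _ _ _ _ hp hp'.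
Qed.

End ParryPolyWellDefined.

Section Solomyak.
Variable R : realType.

(* The alias R[i]^o is what carries the topology given by the modulus. *)
Definition solomyak_G : set R[i] :=
  [set xi | `|xi| < 1 /\
    exists2 a : nat -> R, (forall j, (1 <= j)%N -> 0 <= a j <= 1) &
      (fun n => 1 + \sum_(1 <= j < n) (a j)%:C * xi ^+ j : R[i]^o) @ \oo
        --> (0 : R[i]^o)].

Definition solomyak_Omega : set R[i] :=
  [set xi^-1 | xi in solomyak_G] `|` [set z | `|z| <= 1].

Definition closed_annulus (r s : R) : set R[i] :=
  [set z | r%:C <= `|z| <= s%:C].

End Solomyak.

Section Polynomials.
Variable R : realType.

Definition poly_norm2 (Q : {poly R}) : R :=
  Num.sqrt (\sum_(j < size Q) `|Q`_j| ^+ 2).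

Definition poly_norm1 (Q : {poly R}) : R := \sum_(j < size Q) `|Q`_j|.

Definition poly_degree (P : {poly int}) : nat := (size P).-1.

(* The roots listed with multiplicity: P splits over R[i] as its leading
   coefficient times the product of 'X - z%:P for z in this sequence. *)
Definition complex_roots (P : {poly int}) : seq R[i] :=
  sval (closed_field_poly_normal (map_poly intr P : {poly R[i]})).

Definition root_proportion (P : {poly int}) (A : set R[i]) : R :=
  (count (fun z => `[< A z >]) (complex_roots P))%:R / (poly_degree P)%:R.

End Polynomials.

(* Main.v *)
(** For a root z of the Parry polynomial n put D z := |ln |z||
    = 2 ln (max 1 |z|) - ln |z|. A root outside the annulus has
    D z >= - ln (1 - epsilon) >= epsilon. The root beta is not counted, since
    1 + \sum a_j x^j >= 1 for a_j, x >= 0 forces beta \notin Omega, and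
    D beta = ln beta. Hence, with N the number of counted roots,
    epsilon N + ln beta <= \sum_z D z = 2 ln M(n) - ln |c| - ln |n(0)|, where
    M(n) is the Mahler measure and c the leading coefficient. Both c and n(0)
    are nonzero integers, and Landau's inequality M(n) <= ||n||_2 <= ||n||_1
    concludes. *)
Require Import Defs.
From mathcomp Require Import all_boot all_order all_algebra.
From mathcomp Require Import boolp classical_sets reals topology normedtype.
From mathcomp Require Import sequences exp ring lra.
Import Order.TTheory GRing.Theory Num.Theory.
Local Open Scope classical_set_scope.
Local Open Scope ring_scope.

(** * Landau's inequality between the Mahler measure and the Euclidean norm *)

Section Landau.
Variable C : numClosedFieldType.
Implicit Types (p q : {poly C}) (z : C) (s : seq C).

Definition sqnorm p : C := \sum_(j < size p) `|p`_j| ^+ 2.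

Lemma sqnorm_widen p N : (size p <= N)%N -> sqnorm p = \sum_(j < N) `|p`_j| ^+ 2.
Proof.
move=> pN; rewrite /sqnorm (big_ord_widen N (fun j => `|p`_j| ^+ 2) pN).
rewrite big_mkcond; apply: eq_bigr => j _.
by case: ltnP => // pj; rewrite nth_default // normr0 expr0n.
Qed.

(* Coefficientwise the two squared norms differ by
   (1 - |z|^2) (|q_(j-1)|^2 - |q_j|^2), which telescopes to 0. *)
Lemma sqnorm_reflect q z :
  sqnorm (q * ('X - z%:P)) = sqnorm (q * (z^* *: 'X - 1)).
Proof.
have sz u v : (size (q * (u *: 'X - v%:P))%R <= (size q).+1)%N.
  rewrite (leq_trans (size_polyMleq _ _)) // -subn1 leq_subLR.
  rewrite add1n -addn2 leq_add2l.
  rewrite (leq_trans (size_polyD _ _)) // geq_max size_polyN.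
  by rewrite (leq_trans (size_scale_leq _ _)) ?size_polyX //
             (leq_trans (size_polyC_leq1 _)).
rewrite -[X in q * (X - _)]scale1r -[X in _ = sqnorm (q * (_ - X))]polyC1.
rewrite !(sqnorm_widen _ _ (sz _ _)); apply/eqP; rewrite -subr_eq0 -sumrB.
(* The branch [0] stands for the coefficient of [q] at index -1; the last [g] reads index [size q],
   past the leading coefficient, so both ends vanish. *)
pose g j := (1 - `|z| ^+ 2) * (if j is k.+1 then `|q`_k| ^+ 2 else 0).
have e (j : nat) : true -> `|(q * (1 *: 'X - z%:P))`_j| ^+ 2
     - `|(q * (z^* *: 'X - 1%:P))`_j| ^+ 2 = g j - g j.+1.
  move=> _; rewrite /g !mulrBr -!scalerAr !coefB !coefZ coefMX !coefMC.
  rewrite mul1r mulr1; case: j => [|k] /=; rewrite !normCK; set a := q`_ _;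
    try set b := q`_ _; rewrite !(rmorphB, rmorphM) /= ?conjCK ?rmorph0; ring.
rewrite (eq_bigr (fun j : 'I__ => g j - g j.+1)); last by move=> j _; exact: e.
rewrite -(big_mkord predT (fun j => g j - g j.+1)).
rewrite (eq_bigr (fun j => - (g j.+1 - g j))); last by move=> j _; rewrite opprB.
rewrite sumrN telescope_sumr // /g nth_default // normr0 expr0n /=.
by rewrite mulr0 subr0 oppr0.
Qed.

(** Roots outside the unit circle are reflected in it, which turns the leading coefficient 1 into
    [z^*], of modulus [|z|]. *)
Definition reflect_factor z : {poly C} :=
  if 1 < `|z| then z^* *: 'X - 1 else 'X - z%:P.

(** The free cofactor [q] carries the induction: it absorbs the head factor while the tail is
    reflected. *)
Lemma sqnorm_prod_reflect q s :
  sqnorm (q * \prod_(z <- s) ('X - z%:P)) =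
  sqnorm (q * \prod_(z <- s) reflect_factor z).
Proof.
elim: s q => [|z s IH] q; first by rewrite !big_nil.
rewrite !big_cons !mulrA IH {2}/reflect_factor; case: ifP => _ //.
by rewrite mulrAC sqnorm_reflect mulrAC.
Qed.

(** After reflection the left side is the squared modulus of the leading coefficient, a single term
    of [sqnorm]. *)
Lemma landau_inequality (c : C) s :
  (`|c| * \prod_(z <- s) (if 1 < `|z| then `|z| else 1)) ^+ 2
    <= sqnorm (c *: \prod_(z <- s) ('X - z%:P)).
Proof.
rewrite -mul_polyC sqnorm_prod_reflect; set Q := (X in sqnorm X).
have lcQ : `|lead_coef Q| =
    `|c| * \prod_(z <- s) (if 1 < `|z| then `|z| else 1).
  rewrite lead_coefM lead_coefC lead_coef_prod normrM normr_prod; congr (_ * _).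
  apply: eq_bigr => z _; rewrite /reflect_factor; case: ifP => z1; last first.
    by rewrite lead_coefXsubC normr1.
  have z0 : z^* != 0.
    by rewrite conjC_eq0 -normr_eq0 gt_eqF // (lt_trans ltr01).
  rewrite lead_coefDl ?lead_coefZ ?lead_coefX ?mulr1 ?norm_conjC //.
  by rewrite size_polyN size_poly1 size_scale // size_polyX.
rewrite -lcQ; have [->|Q0] := eqVneq Q 0.
  by rewrite lead_coef0 normr0 expr0n sumr_ge0 // => i _; rewrite exprn_ge0.
rewrite lead_coefE /sqnorm -(prednK (etrans (size_poly_gt0 Q) Q0)) big_ord_recr.
by rewrite lerDr sumr_ge0 // => i _; rewrite exprn_ge0.
Qed.
End Landau.

(** * The orbit of 1, and the Parry polynomial at [beta] and at 0 *)

Section RenyiOrbit.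
Variables (R : realType) (beta : R).
Hypothesis beta_gt1 : 1 < beta.
Local Notation T := (beta_transformation beta).
Local Notation t := (renyi_digit beta).

Let beta_ge0 : 0 <= beta. Proof. exact: le_trans ler01 (ltW beta_gt1). Qed.

Lemma iter_beta_itv k (x : R) : 0 <= x <= 1 -> 0 <= iter k T x <= 1.
Proof.
move=> x01; elim: k => [//|k _]; rewrite iterS /beta_transformation.
have /andP[h1 h2] := floor_itv (beta * iter k T x).
rewrite subr_ge0 h1 lerBlDl addrC.
by rewrite rmorphD /= in h2; rewrite addrC ltW.
Qed.

(** With equal digits each step multiplies the difference by [beta], yet all iterates stay in
    [0, 1], so the difference is 0. *)
Lemma beta_expansion_inj (x y : R) : 0 <= x <= 1 -> 0 <= y <= 1 ->
  (forall k, Num.floor (beta * iter k T x) = Num.floor (beta * iter k T y)) ->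
  x = y.
Proof.
move=> x01 y01 eq_digits.
have diffE k : iter k T x - iter k T y = beta ^+ k * (x - y).
  elim: k => [|k IH]; first by rewrite expr0 mul1r.
  rewrite !iterS {1 3}/beta_transformation eq_digits exprS -mulrA -IH; ring.
have bound k : beta ^+ k * `|x - y| <= 1.
  have := iter_beta_itv k x x01; have := iter_beta_itv k y y01.
  rewrite -[beta ^+ k]ger0_norm ?exprn_ge0 //.
  by move=> /andP[? ?] /andP[? ?]; rewrite -normrM -diffE ler_norml; lra.
have bern k : 1 + k%:R * (beta - 1) <= beta ^+ k.
  elim: k => [|k IH]; first by rewrite mul0r addr0 expr0.
  rewrite exprS -natr1; apply: le_trans (ler_wpM2l beta_ge0 IH).
  have : 0 <= k%:R * (beta - 1) ^+ 2 by rewrite mulr_ge0 ?sqr_ge0.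
  by rewrite expr2; nra.
apply/eqP; rewrite -subr_eq0 -normr_eq0; apply/negPn/negP => d0.
have d_gt0 : 0 < `|x - y| by rewrite lt_def d0 normr_ge0.
set d := `|x - y| in d_gt0 bound *.
have bd_gt0 : 0 < (beta - 1) * d by rewrite mulr_gt0 // subr_gt0.
(* This [k] exceeds [1 / ((beta - 1) * d)], so Bernoulli's inequality [bern] contradicts [bound]. *)
have := archi_boundP (ltW (etrans (invr_gt0 _) bd_gt0)).
set k := Num.bound _; rewrite -[ltLHS]div1r ltr_pdivrMr // => hk.
by have := bound k; have := bern k; nra.
Qed.

(** Links the Parry polynomial to the dynamics: its digit blocks evaluated at [beta] become points
    of the orbit of 1. *)
Lemma iter_beta_1 k :
  iter k T 1 = beta ^+ k - \sum_(1 <= i < k.+1) (t i)%:~R * beta ^+ (k - i).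
Proof.
elim: k => [|k IH]; first by rewrite big_geq // subr0.
rewrite iterS {1}/beta_transformation -/(t k.+1) {1}IH mulrBr -exprS.
rewrite [in RHS]big_nat_recr //= subnn expr0 mulr1 opprD addrA.
congr (_ - _ - _); rewrite mulr_sumr; apply: eq_big_nat => i /andP[_ ik].
by rewrite mulrCA -exprS subSn.
Qed.

(** Both points have the digits of [t] past index [m], hence coincide by injectivity of the
    expansion. *)
Lemma iter_beta_1_eq m p : periodic_after beta m p ->
  iter (m + p.+1) T 1 = iter m T 1.
Proof.
move=> per; apply: beta_expansion_inj;
  try by apply: iter_beta_itv; rewrite ler01 lexx.
move=> k; rewrite -!iterD.
have := per (k + m).+1; rewrite ltnS leq_addl => /(_ isT).
by rewrite /renyi_digit addSn /= addnA.
Qed.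

Lemma horner_digit_sum a N :
  (map_poly intr (\sum_(1 <= i < N) t i *: 'X^(a - i))).[beta] =
  \sum_(1 <= i < N) (t i)%:~R * beta ^+ (a - i) :> R.
Proof.
rewrite rmorph_sum horner_sum; apply: eq_bigr => i _ /=.
by rewrite linearZ /= map_polyXn hornerZ hornerXn.
Qed.

(** The value at [beta] is [T^m 1] in the simple case and [T^(m+p+1) 1 - T^m 1] otherwise, with
    [m = 0] when purely periodic. *)
Lemma parry_poly_root n : is_parry_poly beta n ->
  (map_poly intr n : {poly R}).[beta] = 0.
Proof.
have h01 : 0 <= (1 : R) <= 1 by rewrite ler01 lexx.
case=> [m [_ _ tm]|m p _ [per _] _|p _ [per _]].
- rewrite rmorphB /= map_polyXn hornerD hornerN hornerXn horner_digit_sum.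
  (* Past the last nonzero digit, [T^m 1] has the same digits as 0, namely zeros. *)
  rewrite -iter_beta_1; apply: beta_expansion_inj; rewrite ?lexx ?ler01 //.
    exact: iter_beta_itv.
  have i0 k : iter k T 0 = 0.
    elim: k => // k IH; rewrite iterS IH /beta_transformation mulr0 floor0.
    by rewrite subr0.
  move=> k; rewrite i0 mulr0 floor0 -iterD.
  by have := tm (k + m).+1; rewrite ltnS leq_addl => /(_ isT).
- rewrite rmorphD !rmorphB /= !map_polyXn !(hornerD, hornerN) !hornerXn.
  rewrite !horner_digit_sum -addrA [- beta ^+ m + _]addrC -[_ - beta ^+ m]opprB.
  rewrite -!iter_beta_1.
  by rewrite iter_beta_1_eq // subrr.
- rewrite !rmorphB /= map_polyXn map_polyC !(hornerD, hornerN) /= hornerXn.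
  rewrite hornerC horner_digit_sum.
  have := iter_beta_1_eq 0 p per; rewrite add0n iter_beta_1 big_nat_recr //=.
  by rewrite subnn expr0 mulr1 rmorphD /= => ?; lra.
Qed.

Lemma parry_poly_horner0 n : is_parry_poly beta n -> n.[0] != 0.
Proof.
have sum0 m : (0 < m)%N ->
    (\sum_(1 <= i < m.+1) t i *: 'X^(m - i)).[0] = t m.
  move=> m0; rewrite big_nat_recr //= hornerD horner_sum big_nat big1 ?add0r.
    by rewrite subnn hornerZ hornerXn mulr1.
  move=> i /andP[_ im]; rewrite hornerZ hornerXn expr0n subn_eq0 leqNgt im.
  by rewrite mulr0.
case=> [m [m0 tm _]|m p _ [per pmin] m0|p _ _].
- by rewrite hornerD hornerN hornerXn expr0n sum0 // gtn_eqF // add0r oppr_eq0.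
- rewrite !(hornerD, hornerN) !hornerXn !sum0 ?addnS // !expr0n /= gtn_eqF //.
  rewrite add0r subr0 addrC subr_eq0; apply/eqP => tE.
  (* Were [t m] equal to [t (m + p.+1)], the period would already start at [m - 1], against
     minimality. *)
  have /pmin[] : periodic_after beta m.-1 p.
    move=> i; rewrite prednK // leq_eqVlt => /predU1P[<-|]; last exact: per.
    by rewrite addnS -tE.
  by rewrite -ltnS prednK // ltnn.
- rewrite !(hornerD, hornerN) hornerXn hornerC expr0n /= horner_sum.
  rewrite big_nat big1; last first.
    move=> i /andP[_ ip]; rewrite hornerZ hornerXn expr0n subn_eq0 leqNgt ip.
    by rewrite mulr0.
  rewrite subr0 add0r oppr_eq0 gt_eqF // ltr_wpDr //.
  rewrite /renyi_digit floor_ge0 mulr_ge0 //=.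
  by have /andP[] := iter_beta_itv p 1 (introT andP (conj ler01 (lexx _))).
Qed.
End RenyiOrbit.

(** * Real points of Solomyak's set *)

Lemma real_gt1_notin_Omega (R : realType) (x : R) : 1 < x ->
  ~ solomyak_Omega (real_complex_def (Phant R) x).
Proof.
move=> x1 [|]; last first.
  rewrite /= ger0_norm; last by rewrite (lecR 0) (le_trans ler01) // ltW.
  by rewrite (lecR x 1) leNgt x1.
move=> [xi [_ [a a01 cv]] xiE].
have {}xiE : xi = real_complex_def (Phant R) x^-1.
  by rewrite -[xi]invrK xiE -fmorphV.
(* Some partial sum lies within 1 of the limit 0, whereas each one is [1 + u] with [u] real and
   nonnegative. *)
have := cvgr_dist_lt _ _ cv 1 ltr01 => -[N _ /(_ N (leqnn N))] /=.
rewrite sub0r normrN.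
pose u := \sum_(1 <= j < N) a j * x^-1 ^+ j.
have -> : 1 + \sum_(1 <= j < N) real_complex R (a j) * xi ^+ j =
    real_complex R (1 + u).
  rewrite rmorphD rmorph1 rmorph_sum; congr (_ + _); apply: eq_bigr => j _.
  by rewrite xiE rmorphM rmorphXn.
move=> h.
have u0 : 0 <= u.
  rewrite /u big_nat sumr_ge0 // => i /andP[i1 _].
  have /andP[ai _] := a01 i i1.
  by rewrite mulr_ge0 // exprn_ge0 // invr_ge0 (le_trans ler01) // ltW.
move: h; rewrite ger0_norm ?(lecR 0) ?addr_ge0 //.
by rewrite (ltcR (1 + u) 1) gtrDl ltNge u0.
Qed.

(** * Logarithms of root moduli, and the Mahler measure of integer polynomials *)

Section Modulus.
Variable R : realType.
Local Notation C := R[i].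
Local Notation toC := (real_complex R).

(** The norm of [R[i]] takes values in [R[i]]; [ln] requires a value in [R]. *)
Definition modulus (z : C) : R := complex.Re `|z|.

Lemma modulusE z : toC (modulus z) = `|z|.
Proof. by rewrite /modulus RRe_real // normr_real. Qed.

Lemma modulus_toC x : modulus (toC x) = `|x|.
Proof.
apply: (@complexI R); rewrite modulusE.
by rewrite normc_def /= expr0n addr0 sqrtr_sqr.
Qed.

Lemma modulusM z w : modulus (z * w) = modulus z * modulus w.
Proof. by apply: (@complexI R); rewrite rmorphM /= !modulusE normrM. Qed.

Lemma modulus_gt0 z : (0 < modulus z) = (z != 0).
Proof. by rewrite -ltcR modulusE normr_gt0. Qed.

Lemma ln_prod (I : eqType) (s : seq I) (F : I -> R) : (forall z, z \in s -> 0 < F z) ->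
  0 < \prod_(z <- s) F z /\ ln (\prod_(z <- s) F z) = \sum_(z <- s) ln (F z).
Proof.
elim: s => [|z s IH] F0; first by rewrite !big_nil ln1.
have [|IH0 IHE] := IH; first by move=> w ws; apply: F0; rewrite inE ws orbT.
have Fz := F0 z (mem_head z s).
by rewrite !big_cons mulr_gt0 // lnM // IHE.
Qed.

Definition modulus_ge1 (z : C) : R := if 1 < modulus z then modulus z else 1.

(** For [z != 0] this is [|ln |z||]; in this form its sum over the roots splits into the Mahler
    measure and the product of moduli. *)
Definition log_deviation (z : C) : R := 2 * ln (modulus_ge1 z) - ln (modulus z).

Lemma modulus_ge1_gt0 z : 0 < modulus_ge1 z.
Proof. by rewrite /modulus_ge1; case: ifP => // /(lt_trans ltr01). Qed.

Lemma log_deviation_ge1 z : 1 <= modulus z -> log_deviation z = ln (modulus z).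
Proof.
rewrite /log_deviation /modulus_ge1 le_eqVlt => /predU1P[<-|->]; last by ring.
by rewrite ltxx ln1 mulr0 subr0.
Qed.

Lemma log_deviation_le1 z : modulus z <= 1 -> log_deviation z = - ln (modulus z).
Proof.
by rewrite /log_deviation /modulus_ge1 ltNge => ->; rewrite ln1 mulr0 sub0r.
Qed.

Lemma log_deviation_ge0 z : 0 <= log_deviation z.
Proof.
case: (leP 1 (modulus z)) => [z1|/ltW z1].
  by rewrite log_deviation_ge1 // ln_ge0.
by rewrite log_deviation_le1 // oppr_ge0 ln_le0.
Qed.

(** Outside the annulus [|ln |z||] exceeds [- ln (1 - e)]. The origin is excluded because [ln 0 = 0]
    gives it deviation 0. *)
Lemma log_deviation_outside_annulus (e : R) z : 0 < e < 1 -> z != 0 ->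
  ~ closed_annulus (1 - e) (1 - e)^-1 z -> e <= log_deviation z.
Proof.
move=> /andP[e0 e1] z0 out.
have e1' : 0 < 1 - e by rewrite subr_gt0.
(* This is [ln (1 + x) <= x] at [x = - e]. *)
have lne : e <= - ln (1 - e).
  by rewrite lerNr; apply: le_ln1Dx; rewrite ltrN2.
apply: (le_trans lne); have z_gt0 : 0 < modulus z by rewrite modulus_gt0.
move: out; rewrite /closed_annulus /= -modulusE !lecR => /negP.
rewrite negb_and -!ltNge => /orP[zs|zl].
  rewrite log_deviation_le1; last by rewrite (le_trans (ltW zs)) // gerBl ltW.
  by rewrite lerN2 ler_ln // ltW.
have zl1 : 1 <= modulus z.
  by rewrite (le_trans _ (ltW zl)) // invf_ge1 // gerBl ltW.
by rewrite log_deviation_ge1 // -lnV // ler_ln ?ltW // posrE invr_gt0.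
Qed.

Lemma count_le_log_deviation (A : set C) (e b : R) (s : seq C) :
  0 < e < 1 -> 1 < b -> toC b \in s -> ~ A (toC b) ->
  (forall z, z \in s -> z != 0) ->
  (forall z, A z -> ~ closed_annulus (1 - e) (1 - e)^-1 z) ->
  e * (count (fun z => `[< A z >]) s)%:R + ln b <= \sum_(z <- s) log_deviation z.
Proof.
move=> e01 b1 bs Ab s0 Aout.
have b0 : 0 < b := lt_trans ltr01 b1.
(* One occurrence of [b] is split off: it adds nothing to the count and [ln b] to the sum. Each
   remaining root is then estimated separately. *)
have /permP -> := perm_to_rem bs.
rewrite (big_rem _ bs) /= (asboolF Ab) add0n addrC lerD //; last first.
  by rewrite log_deviation_ge1 modulus_toC gtr0_norm // ltW.
have {}s0 z : z \in rem (toC b) s -> z != 0 by move=> /mem_rem/s0.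
elim: (rem _ _) s0 => [|z r IH] s0; first by rewrite big_nil mulr0.
rewrite big_cons /= natrD mulrDr lerD //; last first.
  by apply: IH => w wr; apply: s0; rewrite inE wr orbT.
case: asboolP => [Az|_]; last by rewrite mulr0 log_deviation_ge0.
rewrite mulr1; apply: log_deviation_outside_annulus => //; last exact: Aout.
by rewrite s0 // mem_head.
Qed.

Lemma modulus_intr (k : int) : modulus k%:~R = `|k%:~R|.
Proof. by rewrite -modulus_toC rmorph_int. Qed.

Lemma complex_rootsE (n : {poly int}) :
  map_poly intr n = (lead_coef n)%:~R *: \prod_(z <- complex_roots R n) ('X - z%:P)
  :> {poly C}.
Proof.
rewrite /complex_roots; case: closed_field_poly_normal => s /= {1}->.
by rewrite lead_coef_map_inj //; apply: intr_inj.
Qed.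

Lemma mem_complex_roots (n : {poly int}) z : n != 0 ->
  (z \in complex_roots R n) = root (map_poly intr n) z.
Proof.
move=> n0; rewrite complex_rootsE rootZ ?root_prod_XsubC //.
by rewrite intr_eq0 lead_coef_eq0.
Qed.

Lemma map_poly_intr_toC (n : {poly int}) :
  map_poly intr n = map_poly toC (map_poly intr n) :> {poly C}.
Proof.
rewrite -map_poly_comp; apply: eq_map_poly => k /=.
by rewrite rmorph_int.
Qed.

Lemma modulus_horner0 (n : {poly int}) :
  `|(map_poly intr n : {poly R}).[0]| =
  `|(lead_coef n)%:~R| * \prod_(z <- complex_roots R n) modulus z.
Proof.
rewrite -modulus_toC -horner_map /= -map_poly_intr_toC complex_rootsE rmorph0.
rewrite hornerZ horner_prod modulusM modulus_intr; congr (_ * _).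
apply: (@complexI R); rewrite modulusE normr_prod rmorph_prod.
by apply: eq_bigr => z _; rewrite /= modulusE hornerXsubC sub0r normrN.
Qed.

Lemma mahler_le_norm2 (n : {poly int}) :
  `|(lead_coef n)%:~R| * \prod_(z <- complex_roots R n) modulus_ge1 z <=
  poly_norm2 (map_poly intr n).
Proof.
set M := (X in X <= _).
have M0 : 0 <= M.
  by rewrite mulr_ge0 // prodr_ge0 // => z _; rewrite ltW // modulus_ge1_gt0.
rewrite -[M]ger0_norm // -sqrtr_sqr ler_wsqrtr // -lecR rmorphXn /=.
have -> : toC M = `|(lead_coef n)%:~R| *
    \prod_(z <- complex_roots R n) (if 1 < `|z| then `|z| else 1).
  rewrite rmorphM rmorph_prod /= -modulus_intr modulusE; congr (_ * _).
  apply: eq_bigr => z _; rewrite /modulus_ge1 -!modulusE -(rmorph1 toC) ltcR.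
  by case: ifP.
apply: le_trans (landau_inequality _ _ _) _.
rewrite -complex_rootsE map_poly_intr_toC.
rewrite /sqnorm size_map_poly rmorph_sum /= le_eqVlt; apply/orP; left.
apply/eqP/eq_bigr => j _.
by rewrite coef_map rmorphXn /= -modulusE modulus_toC.
Qed.

Lemma norm2_le_norm1 (Q : {poly R}) : poly_norm2 Q <= poly_norm1 Q.
Proof.
have Q0 : 0 <= poly_norm1 Q by rewrite sumr_ge0.
rewrite -[leRHS]ger0_norm // -sqrtr_sqr ler_wsqrtr // /poly_norm1.
elim: (size Q) => [|k IH]; first by rewrite !big_ord0 expr0n.
rewrite !big_ord_recr /= sqrrD.
(* The cross terms in the square of the sum are nonnegative. *)
have : 0 <= \sum_(i < k) `|Q`_i| * `|Q`_k|.
  by apply: sumr_ge0 => i _; rewrite mulr_ge0.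
by rewrite -mulr_suml => h; rewrite lerD // (le_trans IH) // lerDl mulrn_wge0.
Qed.
End Modulus.

(** * The two bounds on the proportion of roots *)

Theorem theorem3p2 (R : realType) (beta epsilon : R) (n : {poly int}) :
  1 < beta -> beta \isn't a Num.int ->
  parry_number beta -> is_parry_poly beta n -> (1 <= poly_degree n)%N ->
  0 < epsilon < 1 ->
  let dP : R := (poly_degree n)%:R in
  let nR : {poly R} := map_poly intr n in
  let mu : R := root_proportion n
    (@solomyak_Omega R `\` closed_annulus (1 - epsilon) (1 - epsilon)^-1) in
  mu <= 2 / (epsilon * dP) * (ln (poly_norm2 nR) - 1 / 2 * ln beta) /\
  mu <= 2 / (epsilon * dP) * (ln (poly_norm1 nR) - 1 / 2 * ln `|nR.[0]|).
Proof.
move=> beta1 _ _ nP deg e01 dP nR mu; have /andP[e0 _] := e01.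
have d0 : 0 < dP by rewrite ltr0n.
have n0 : n != 0 by apply: contraTneq deg => ->; rewrite /poly_degree size_poly0.
pose A : set R[i] :=
  @solomyak_Omega R `\` closed_annulus (1 - epsilon) (1 - epsilon)^-1.
set s := complex_roots R n; set N : R := (count (fun z => `[< A z >]) s)%:R.
(* Clearing [epsilon * dP] turns both goals into upper bounds on [epsilon * N]. *)
have muE X : (mu <= 2 / (epsilon * dP) * X) = (epsilon * N <= 2 * X).
  have -> : 2 / (epsilon * dP) * X = 2 * X / epsilon / dP.
    by field; rewrite !gt_eqF.
  by rewrite ler_pM2r ?invr_gt0 // ler_pdivlMr // mulrC.
have c1 : 1 <= `|(lead_coef n)%:~R| :> R.
  by rewrite norm_intr_ge1 // ?intr_int // intr_eq0 lead_coef_eq0.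
have p1 : 1 <= `|nR.[0]|.
  rewrite -(rmorph0 intr) horner_map norm_intr_ge1 ?intr_int // intr_eq0.
  exact: parry_poly_horner0 nP.
have nR0 : nR.[0] != 0 by rewrite -normr_gt0 (lt_le_trans ltr01).
have s0 z : z \in s -> z != 0.
  rewrite mem_complex_roots // => rz; apply: contraNneq nR0 => z0.
  move: rz; rewrite z0 map_poly_intr_toC -(rmorph0 (real_complex R)).
  by rewrite fmorph_root.
have bs : real_complex R beta \in s.
  by rewrite mem_complex_roots // map_poly_intr_toC fmorph_root /root
             parry_poly_root.
have bA : ~ A (real_complex R beta) by move=> [/(real_gt1_notin_Omega _ _ beta1)].
have Aout z : A z -> ~ closed_annulus (1 - epsilon) (1 - epsilon)^-1 z by case.
have := count_le_log_deviation R A epsilon beta s e01 beta1 bs bA s0 Aout.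
rewrite -/N sumrB -mulr_sumr.
have [pm0 <-] := @ln_prod R _ s (@modulus_ge1 R) (fun z _ => modulus_ge1_gt0 R z).
have [pz0 <-] := @ln_prod R _ s (@modulus R)
  (fun z zs => etrans (modulus_gt0 R z) (s0 z zs)).
have c0 : 0 < `|(lead_coef n)%:~R| :> R := lt_le_trans ltr01 c1.
have := ln_ge0 p1; have := ln_ge0 c1; have := ln_ge0 (ltW beta1).
have := modulus_horner0 R n; rewrite -/nR -/s => ->.
have Mn2 : _ <= poly_norm2 nR := mahler_le_norm2 R n.
have n21 := norm2_le_norm1 R nR.
have M0 := mulr_gt0 c0 pm0.
have n2_gt0 := lt_le_trans M0 Mn2; have n1_gt0 := lt_le_trans n2_gt0 n21.
have : ln (poly_norm2 nR) <= ln (poly_norm1 nR) by rewrite ler_ln.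
have := Mn2; rewrite -ler_ln // !muE (lnM c0 pm0) (lnM c0 pz0).
(* From [epsilon * N + ln beta <= 2 ln M - ln |c| - ln |n(0)|], bound (i) drops the last two
   logarithms and bound (ii) drops [ln beta] and [ln |c|], all nonnegative. *)
move=> *; split; lra.
Qed.
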